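(* There exist an absolute constant $\gamma > 0$ and an integer $r_0$ such that for every integer $r \geq r_0$ there is a function $\phi : \{-1,1\}^r \to \mathbb{C}$, 1-Lipschitz in the Hamming metric, with the following property: for every integer $c \geq 1$, the function $$f = \underbrace{\phi + \cdots + \phi}_{c \text{ times}}$$ satisfies $\mathbf{E}\, e^{\lambda f} = 0$ for some $\lambda \in \mathbb{C}$ with $$|\lambda| \leq \frac{\gamma}{c\sqrt{r}}.$$ In particular (case $c=1$), $\mathbf{E}\, e^{\lambda \phi} = 0$ for some $\lambda\in\mathbb{C}$ with $|\lambda| \leq \gamma/\sqrt{r}$.
   Context: $\mathbf{E}$ denotes expectation with respect to the uniform probability measure on $\{-1,1\}^r$. A function $\phi : \{-1,1\}^r \to \mathbb{C}$ is 1-Lipschitz in the Hamming metric if $|\phi(x) - \phi(y)| \leq 1$ whenever $x, y$ differ in exactly one coordinate. *)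

(* Defs.v *)
From HB Require Import structures.
From mathcomp Require Import all_boot all_order all_algebra.
From mathcomp Require Import reals sequences exp trigo.
From mathcomp Require Import complex.

Set Implicit Arguments.
Unset Strict Implicit.
Unset Printing Implicit Defensive.

Import Order.TTheory GRing.Theory Num.Theory.
Local Open Scope ring_scope.
Local Open Scope complex_scope.

Definition sign : Type := seq_sub [:: -1; 1 : int].
HB.instance Definition _ := Finite.on sign.

Notation cube r := {ffun 'I_r -> sign}.

Definition cexp (R : realType) (z : R[i]) : R[i] :=
  (expR (complex.Re z))%:C * (cos (complex.Im z) +i* sin (complex.Im z)).

Definition expectation (R : realType) (r : nat) (F : cube r -> R[i]) : R[i] :=
  (\sum_(x : cube r) F x) / #|{: cube r}|%:R.

Definition differ_in_one (r : nat) (x y : cube r) : bool :=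
  #|[set i | x i != y i]| == 1%N.

(* The norm of R[i] takes its values in R[i]; z <= w there means that w - z
   is a nonnegative real, so between norms and embedded reals it is the order
   of R. *)
Definition lipschitz1 (R : realType) (r : nat) (phi : cube r -> R[i]) : Prop :=
  forall x y : cube r, differ_in_one x y -> `|phi x - phi y| <= 1.

(* Main.v *)
(* Let S be the sum of the r coordinates and u = clip (v S) its truncation to
   [-1, 1]. Take lambda phi = 4 |u| + i pi u with lambda proportional to v.
   The symmetry x -> - x kills the imaginary part of E exp (lambda phi); the
   real part is the mean of wave (v S) = exp (4 |u|) cos (pi u). It is 1 at
   v = 0, and at v = 4 / sqrt r it is nonpositive: where u = 1 or u = -1, the
   wave is - e^4, and elsewhere at most e^2, so the second and fourth moments
   of S suffice. The intermediate value theorem gives a zero in between.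
   The factor e^4 is what makes the crude bound E S^4 <= 3 r^2 enough. *)
Require Import Defs.
From mathcomp Require Import all_boot all_order all_algebra.
From mathcomp Require Import reals complex.
From mathcomp Require Import classical_sets topology normedtype sequences exp trigo.
From mathcomp Require Import ring lra.

Import Order.TTheory GRing.Theory Num.Theory.
Import numFieldNormedType.Exports.

Local Open Scope ring_scope.
Local Open Scope complex_scope.

(** * Signs and sign flips on the cube *)

Definition sgn (R : realType) (s : sign) : R := (ssval s)%:~R.
Arguments sgn {R} s.

Lemma sign_opp_subproof (s : sign) : - ssval s \in [:: -1; 1 : int].
Proof. by case: s => a /=; rewrite !inE => /orP[] /eqP ->. Qed.

Definition sign_opp (s : sign) : sign := SeqSub (sign_opp_subproof s).

Lemma sign_oppK : involutive sign_opp.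
Proof. by move=> s; apply: val_inj; rewrite /= opprK. Qed.

Lemma sgn_opp (R : realType) (s : sign) : @sgn R (sign_opp s) = - @sgn R s.
Proof. by rewrite /sgn /= rmorphN. Qed.

Lemma sgn_pm1 (R : realType) (s : sign) : @sgn R s = 1 \/ @sgn R s = -1.
Proof.
rewrite /sgn; case: s => a /=; rewrite !inE => /orP[] /eqP ->.
  by right; rewrite rmorphN1.
by left.
Qed.

Definition flip (r : nat) (A : {set 'I_r}) (x : cube r) : cube r :=
  [ffun i => if i \in A then sign_opp (x i) else x i].

Lemma flipK (r : nat) (A : {set 'I_r}) : involutive (flip r A).
Proof.
by move=> x; apply/ffunP => i; rewrite !ffunE; case: (i \in A); rewrite ?sign_oppK.
Qed.

(** A flip is an involution of the cube, so reindexing by it shows that the sum equals its own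
    opposite. *)
Lemma sum_flip_odd (R : realType) (r : nat) (A : {set 'I_r}) (g : cube r -> R) :
  (forall x, g (flip r A x) = - g x) -> \sum_x g x = 0.
Proof.
move=> g_odd; apply/eqP; rewrite -[_ == 0](mulrn_eq0 _ 2) mulr2n.
rewrite {1}(reindex_inj (inv_inj (@flipK r A))) /=.
by under eq_bigr do rewrite g_odd; rewrite sumrN addNr.
Qed.

Lemma cube_card_gt0 (r : nat) : (0 < #|{: cube r}|)%N.
Proof.
have s : sign by apply: (@SeqSub _ _ 1); rewrite !inE.
by apply/card_gt0P; exists [ffun => s].
Qed.

(** * Second and fourth moments of sums of distinct coordinates *)

Section Moments.
Variables (R : realType) (r : nat).
Implicit Types (x : cube r) (s : seq 'I_r).

Definition psum s x : R := \sum_(i <- s) sgn (x i).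

Lemma psum_flip_notin s i x : i \notin s -> psum s (flip r [set i] x) = psum s x.
Proof.
move=> is'; apply: eq_big_seq => j js; rewrite ffunE inE.
by case: eqP is' => // <-; rewrite js.
Qed.

(** Flipping coordinate [i] alone negates [sgn (x i)] and fixes [psum s x]. This stands in for
    independence: it kills every odd cross term in the moment computations. *)
Lemma sum_sgn_psum0 s i (h : R -> R) : i \notin s ->
  \sum_(x : cube r) sgn (x i) * h (psum s x) = 0.
Proof.
move=> is'; apply: (@sum_flip_odd R r [set i]) => x.
by rewrite psum_flip_notin // ffunE set11 sgn_opp mulNr.
Qed.

Lemma sgn_sqr (t : sign) : sgn t ^+ 2 = 1 :> R.
Proof. by case: (sgn_pm1 R t) => ->; rewrite ?sqrrN expr1n. Qed.

Lemma sum_psum2 s : uniq s ->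
  \sum_x psum s x ^+ 2 = (size s)%:R * #|{: cube r}|%:R.
Proof.
elim: s => [_|i s IH /= /andP[is' us]].
  by rewrite mul0r big1 // => x _; rewrite /psum big_nil expr0n.
under eq_bigr => x _.
  rewrite /psum big_cons -/(psum s x) sqrrD sgn_sqr -mulrnAr.
  over.
rewrite !big_split /= (@sum_sgn_psum0 s i (fun t => t *+ 2)) // addr0 IH //.
by rewrite sumr_const mulrS mulrDl mul1r.
Qed.

Lemma sum_psum4 s : uniq s ->
  \sum_x psum s x ^+ 4 <= 3 * (size s)%:R ^+ 2 * #|{: cube r}|%:R.
Proof.
set N : R := #|_|%:R; have N0 : 0 <= N by rewrite ler0n.
(* The induction runs on the exact value 3 n^2 - 2 n of the fourth moment, n being the length of
   [s]; the bound then drops 2 n. *)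
move=> us; suff -> : \sum_x psum s x ^+ 4 =
    (3 * (size s)%:R ^+ 2 - 2 * (size s)%:R) * N.
  by rewrite ler_wpM2r // gerBl mulr_ge0 // ler0n.
elim: s us => [_|i s IH /= /andP[is' us]].
  rewrite big1 /=; first by ring.
  by move=> x _; rewrite /psum big_nil expr0n.
under eq_bigr => x _.
  have -> : psum (i :: s) x ^+ 4 = psum s x ^+ 4 + 6 * psum s x ^+ 2 + 1 +
     sgn (x i) * (4 * psum s x ^+ 3 + 4 * psum s x).
    rewrite /psum big_cons -/(psum s x).
    by case: (sgn_pm1 R (x i)) => ->; ring.
  over.
rewrite !big_split /= (@sum_sgn_psum0 s i (fun t => 4 * t ^+ 3 + 4 * t)) //.
rewrite IH // -mulr_sumr sum_psum2 // sumr_const -/N mulrS; ring.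
Qed.

End Moments.

Arguments psum {R r} s x.

(** * Truncation to [-1, 1] and the wave *)

Section Clip.
Variable R : realType.
Implicit Types w v : R.

(** Written with absolute values, the truncation inherits continuity and the Lipschitz bound from
    the norm. *)
Definition clip w : R := (`|w + 1| - `|w - 1|) / 2.

Lemma clip_id w : `|w| <= 1 -> clip w = w.
Proof.
rewrite ler_norml /clip => /andP[w1 w2].
rewrite (ger0_norm (_ : 0 <= w + 1)); last by lra.
rewrite (ler0_norm (_ : w - 1 <= 0)); last by lra.
by lra.
Qed.

Lemma clip_out w : 1 <= `|w| -> `|clip w| = 1.
Proof.
rewrite ler_normr /clip => /orP[] w1.
  rewrite (ger0_norm (_ : 0 <= w + 1)); last by lra.
  rewrite (ger0_norm (_ : 0 <= w - 1)); last by lra.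
  have -> : (w + 1 - (w - 1)) / 2 = 1 by lra.
  exact: normr1.
rewrite (ler0_norm (_ : w + 1 <= 0)); last by lra.
rewrite (ler0_norm (_ : w - 1 <= 0)); last by lra.
have -> : (- (w + 1) - - (w - 1)) / 2 = -1 by lra.
by rewrite normrN1.
Qed.

Lemma clipN w : clip (- w) = - clip w.
Proof.
rewrite /clip -(normrN (- w + 1)) -(normrN (- w - 1)) !opprD !opprK.
lra.
Qed.

Lemma clip_lipschitz w v : `|clip w - clip v| <= `|w - v|.
Proof.
have := ler_dist_dist (w + 1) (v + 1); have := ler_dist_dist (w - 1) (v - 1).
have -> : w + 1 - (v + 1) = w - v by ring.
have -> : w - 1 - (v - 1) = w - v by ring.
rewrite !ler_norml /clip; lra.
Qed.

Definition wave w : R := expR (4 * `|clip w|) * cos (pi * clip w).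

Lemma continuous_wave : continuous wave.
Proof.
have Cclip : continuous clip.
  move=> w; apply: cvgM; last exact: cvg_cst.
  by apply: cvgB; apply: cvg_norm; apply: cvgD; [exact: cvg_id|exact: cvg_cst|
    exact: cvg_id|exact: cvg_cst].
move=> w; apply: cvgM.
  apply: (@continuous_comp _ _ _ (fun w => 4 * `|clip w|)); last exact: continuous_expR.
  by apply: cvgM; [exact: cvg_cst|apply: cvg_norm; exact: Cclip].
apply: (@continuous_comp _ _ _ (fun w => pi * clip w)); last exact: continuous_cos.
by apply: cvgM; [exact: cvg_cst|exact: Cclip].
Qed.

Lemma wave0 : wave 0 = 1.
Proof. by rewrite /wave clip_id ?normr0 // !mulr0 expR0 cos0 mulr1. Qed.

Lemma wave_out w : 1 <= `|w| -> wave w = - expR 2 ^+ 2.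
Proof.
move=> w1; rewrite /wave -cos_norm (normrM pi) clip_out // ger0_norm ?pi_ge0 //.
by rewrite !mulr1 cospi mulrN1 expr2 -expRD; congr (- expR _); lra.
Qed.

(** For |w| <= 1/2 the exponent is at most 2 and the cosine lies in [0, 1]; for 1/2 < |w| <= 1 the
    cosine is nonpositive. *)
Lemma wave_in w : `|w| <= 1 -> wave w <= expR 2.
Proof.
move=> w1; rewrite /wave clip_id //; case: (leP `|w| (1 / 2)) => w2.
  rewrite -[leRHS]mulr1 ler_pM ?cos_le1 ?expR_ge0 //; last first.
    by rewrite ler_expR; lra.
  apply: cos_ge0_pihalf; rewrite -ler_norml (normrM pi) ger0_norm ?pi_ge0 //.
  by have := pi_ge0 R; nra.
apply: (@le_trans _ _ 0); last exact: expR_ge0.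
rewrite pmulr_rle0 ?expR_gt0 // -cos_norm (normrM pi) ger0_norm ?pi_ge0 //.
have pi_w : 0 <= pi * `|w| - pi / 2 <= pi by have := pi_ge0 R; nra.
have -> : pi * `|w| = (pi * `|w| - pi / 2) + pi / 2 by rewrite subrK.
by rewrite cosDpihalf oppr_le0 sin_ge0_pi.
Qed.

End Clip.

Arguments clip {R} w.
Arguments wave {R} w.

(** * A zero of the mean wave in (0, 4 / sqrt r] *)

Definition total {R : realType} {r : nat} (x : cube r) : R := psum (enum 'I_r) x.

Lemma total_flip_all (R : realType) (r : nat) (x : cube r) :
  total (flip r [set: 'I_r] x) = - @total R r x.
Proof.
by rewrite /total /psum -sumrN; apply: eq_bigr => i _; rewrite ffunE inE sgn_opp.
Qed.

Lemma total_differ_in_one (R : realType) (r : nat) (x y : cube r) :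
  differ_in_one x y -> `|@total R r x - total y| <= 2.
Proof.
move=> /cards1P[i /setP xy]; rewrite /total /psum !big_enum /= -sumrB.
rewrite (bigD1 i) //= big1 => [|j ji].
  rewrite addr0.
  by case: (sgn_pm1 R (x i)) => ->; case: (sgn_pm1 R (y i)) => ->;
    rewrite ler_norml; lra.
by have := xy j; rewrite !inE (negPf ji) => /negbFE/eqP ->; rewrite subrr.
Qed.

(* The quartic has its minimum - e^4 at s^2 = 3 q^2, and it has mean at most 0
   when s has second moment q^2 and fourth moment at most 3 q^4. *)
Lemma wave_le_quartic (R : realType) (q s : R) : 0 < q ->
  wave (4 / q * s) <=
  expR 2 ^+ 2 * (1 / 2 - (s / q) ^+ 2 + (s / q) ^+ 4 / 6).
Proof.
move=> q0; have -> : 4 / q * s = 4 * (s / q) by rewrite mulrAC mulrA.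
move: (s / q) => {q0}t; set K := expR 2.
(* Since 3 > 16/7, this gives K <= (7/16) K^2, where 7/16 = 1/2 - 1/16 bounds the quartic from below
   when |4 t| <= 1. *)
have K3 : 3 <= K by apply: le_trans (expR_ge1Dx 2); lra.
case: (leP `|4 * t| 1) => [t1|/ltW t1].
  apply: (le_trans (@wave_in R _ t1)); rewrite -/K.
  have t2 : t ^+ 2 <= 1 / 16.
    by move: t1; rewrite ler_norml => ?; nra.
  have : 0 <= t ^+ 4 / 6 by rewrite divr_ge0 // exprn_even_ge0.
  move: (t ^+ 4 / 6) => w w0.
  have : K * (7 / 16) <= K * (1 / 2 - t ^+ 2 + w) by rewrite ler_pM2l; lra.
  by rewrite expr2 -mulrA; nra.
rewrite wave_out // -/K.
have -> : 1 / 2 - t ^+ 2 + t ^+ 4 / 6 = (t ^+ 2 - 3) ^+ 2 / 6 - 1 by field.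
have : 0 <= K ^+ 2 * ((t ^+ 2 - 3) ^+ 2 / 6) by rewrite mulr_ge0 ?divr_ge0 ?sqr_ge0.
rewrite mulrBr mulr1; lra.
Qed.

Lemma sum_wave_le0 (R : realType) (r : nat) : (0 < r)%N ->
  \sum_(x : cube r) wave (4 / Num.sqrt r%:R * @total R r x) <= 0.
Proof.
move=> r0; set q : R := Num.sqrt r%:R.
have r0' : 0 < (r%:R : R) by rewrite ltr0n.
have q0 : 0 < q by rewrite sqrtr_gt0.
have q2 : q ^+ 2 = r%:R by rewrite sqr_sqrtr ?ler0n.
apply: (@le_trans _ _ (\sum_(x : cube r)
   expR 2 ^+ 2 * (1 / 2 - (total x / q) ^+ 2 + (total x / q) ^+ 4 / 6))).
  by apply: ler_sum => x _; exact: wave_le_quartic.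
rewrite -mulr_sumr pmulr_rle0 ?exprn_gt0 ?expR_gt0 // !big_split /= sumrN.
rewrite [X in _ - X + _](eq_bigr (fun x : cube r => total x ^+ 2 * q^-1 ^+ 2)); last first.
  by move=> x _; rewrite exprMn.
rewrite [X in _ + X <= _](eq_bigr (fun x : cube r => total x ^+ 4 * (q^-1 ^+ 4 / 6))); last first.
  by move=> x _; rewrite exprMn -[LHS]mulrA.
rewrite -!mulr_suml sumr_const.
have sz : size (enum 'I_r) = r by rewrite size_enum_ord.
have := @sum_psum2 R r _ (enum_uniq 'I_r); have := @sum_psum4 R r _ (enum_uniq 'I_r).
rewrite sz -/(@total R r) => m4 ->.
rewrite exprVn q2 mulrAC mulfV ?gt_eqF // mul1r.
set N : R := #|_|%:R in m4 *.
(* After division by N, the constant term contributes 1/2 and the quadratic one -1, so the quartic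
   one may contribute up to 1/2 = 3 r^2 / (6 r^2). *)
have : (\sum_(x : cube r) total x ^+ 4) * (q^-1 ^+ 4 / 6) <= N / 2 :> R.
  have -> : q^-1 ^+ 4 / 6 = (6 * r%:R ^+ 2)^-1 :> R.
    by rewrite -q2 -exprM exprVn mulrC -invfM.
  rewrite ler_pdivrMr ?mulr_gt0 ?exprn_gt0 //.
  by apply: (le_trans m4); rewrite le_eqVlt; apply/orP; left; apply/eqP; field.
lra.
Qed.

Lemma exists_wave_zero (R : realType) (r : nat) : (0 < r)%N ->
  exists2 v : R, 0 < v <= 4 / Num.sqrt r%:R &
    \sum_(x : cube r) wave (v * total x) = 0.
Proof.
move=> r0; set q : R := Num.sqrt r%:R.
have q0 : 0 < q by rewrite sqrtr_gt0 ltr0n.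
pose F (v : R) := \sum_(x : cube r) wave (v * total x).
have F0 : 0 < F 0.
  rewrite /F; under eq_bigr do rewrite mul0r wave0.
  by rewrite sumr_const pmulrn_lgt0 // cube_card_gt0.
have F4 : F (4 / q) <= 0 by exact: sum_wave_le0.
have le04 : 0 <= 4 / q by rewrite divr_ge0 // ltW.
have cF : continuous F.
  apply: continuous_big => [|x _ v]; first exact: add_continuous.
  apply: (@continuous_comp R R R (fun v => v * total x) (@wave R) v); last exact: continuous_wave.
  by apply: cvgM; [exact: cvg_id|exact: cvg_cst].
have [||v] := @IVT R F 0 (4 / q) 0 le04.
- exact: continuous_subspaceT.
- by rewrite ge_min F4 orbT le_max ltW.
rewrite in_itv /= => /andP[v0 v4] Fv; exists v => //.
(* The zero is not at 0, where F is positive; with v > 0 the scale of [phi] can later be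
   inverted. *)
rewrite v4 lt_neqAle v0 !andbT; apply/eqP => v0'.
by move: F0; rewrite [in F 0]v0' [F v]Fv ltxx.
Qed.

(** * Complex bookkeeping and the construction of [phi] *)

Lemma normc_le_add (R : realType) (a b : R) : `|a +i* b| <= (`|a| + `|b|)%:C.
Proof.
rewrite normc_def lecR /= -[leRHS]ger0_norm ?addr_ge0 // -sqrtr_sqr.
rewrite ler_sqrt ?sqr_ge0 // sqrrD !real_normK ?num_real //.
by rewrite lerD2r lerDl mulrn_wge0 ?mulr_ge0.
Qed.

Lemma sum_complex (R : realType) (I : finType) (a b : I -> R) :
  \sum_i (a i +i* b i) = (\sum_i a i) +i* (\sum_i b i).
Proof. by elim/big_rec3: _ => // i x y z _ ->. Qed.

Theorem mainTheorem3 (R : realType) :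
  exists2 gamma : R, 0 < gamma &
  exists r0 : nat, forall r : nat, (r0 <= r)%N ->
  exists2 phi : cube r -> R[i], lipschitz1 phi &
    (forall c : nat, (1 <= c)%N ->
       let f : cube r -> R[i] := fun x => \sum_(j < c) phi x in
       exists2 lambda : R[i],
         expectation (fun x => cexp (lambda * f x)) = 0 &
         `|lambda| <= (gamma / (c%:R * Num.sqrt (r%:R : R)))%:C) /\
    (exists2 lambda : R[i],
       expectation (fun x => cexp (lambda * phi x)) = 0 &
       `|lambda| <= (gamma / Num.sqrt (r%:R : R))%:C).
Proof.
have pi0 := pi_ge0 R.
(* The zero will be at lambda = 2 v (4 + pi) with v <= 4 / sqrt r. *)
exists (8 * (4 + pi)); first by lra.
exists 1%N => r r0; set q : R := Num.sqrt r%:R.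
have q0 : 0 < q by rewrite sqrtr_gt0 ltr0n.
have [v /andP[v0 v4] Fv] := @exists_wave_zero R r r0.
pose u (x : cube r) : R := clip (v * total x).
(* One coordinate change moves the total by at most 2, hence u by at most 2 v and 4 |u| + i pi u by
   at most [l]. Dividing by [l] makes [phi] 1-Lipschitz, and lambda = [l] undoes the division. *)
pose l : R := 2 * v * (4 + pi).
have l0 : 0 < l by rewrite /l; nra.
pose phi (x : cube r) : R[i] := (l^-1)%:C * ((4 * `|u x|) +i* (pi * u x)).
have lphi x : l%:C * phi x = (4 * `|u x|) +i* (pi * u x).
  by rewrite /phi mulrA -rmorphM mulfV ?gt_eqF // rmorph1 mul1r.
have u_lip x y : differ_in_one x y -> `|u x - u y| <= 2 * v.
  move=> /(@total_differ_in_one R) xy; apply: le_trans (@clip_lipschitz R _ _) _.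
  by rewrite -mulrBr normrM (gtr0_norm v0) mulrC ler_wpM2r // ltW.
have phi0 : expectation (fun x => cexp (l%:C * phi x)) = 0.
  rewrite /expectation; under eq_bigr => x _.
    rewrite lphi /cexp /=; over.
  have -> : \sum_(x : cube r) (expR (4 * `|u x|))%:C *
      (cos (pi * u x) +i* sin (pi * u x)) =
    (\sum_(x : cube r) wave (v * total x)) +i*
    (\sum_(x : cube r) expR (4 * `|u x|) * sin (pi * u x)).
    rewrite -sum_complex; apply: eq_bigr => x _; rewrite /wave -/(u x).
    by apply/eqP; rewrite eq_complex /= !mul0r subr0 addr0 !eqxx.
  (* The real part vanishes by the choice of v; the imaginary part is odd under flipping all
     coordinates. *)
  rewrite Fv [X in _ +i* X](@sum_flip_odd R r [set: 'I_r]) ?mul0r // => x.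
  have -> : u (flip r [set: 'I_r] x) = - u x by rewrite /u total_flip_all mulrN clipN.
  by rewrite normrN mulrN sinN mulrN.
have l_le : `|l%:C| <= (8 * (4 + pi) / q)%:C.
  rewrite normc_def /= expr0n addr0 sqrtr_sqr gtr0_norm // lecR /l.
  have -> : 8 * (4 + pi) / q = 2 * (4 / q) * (4 + pi) by field; rewrite gt_eqF.
  by rewrite ler_wpM2r ?ler_wpM2l //; lra.
exists phi.
  move=> x y xy; rewrite /phi -mulrBr normrM.
  have -> : `|(l^-1)%:C| = (l^-1)%:C :> R[i].
    by rewrite normc_def /= expr0n addr0 sqrtr_sqr gtr0_norm // invr_gt0.
  have -> : 1 = (l^-1)%:C * l%:C by rewrite -rmorphM mulVf ?gt_eqF // rmorph1.
  rewrite ler_wpM2l ?ler0c ?invr_ge0 ?(ltW l0) //.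
  apply: le_trans (normc_le_add _ _ _) _; rewrite lecR -!mulrBr.
  rewrite (normrM 4) (normrM pi) (ger0_norm pi0) (normr_nat _ 4) /l.
  have -> : 2 * v * (4 + pi) = 4 * (2 * v) + pi * (2 * v) by ring.
  have uxy := u_lip x y xy.
  by rewrite lerD ?ler_wpM2l //; apply: le_trans uxy; exact: ler_dist_dist.
split=> [c c0 f|]; last by exists l%:C.
have c0' : (c%:R : R[i]) != 0 by rewrite pnatr_eq0 -lt0n.
(* As f = c [phi], this lambda gives lambda f = [l] [phi], the case already settled. *)
exists (l%:C / c%:R).
  rewrite -phi0; congr (_ / _); apply: eq_bigr => x _; congr cexp.
  by rewrite /f sumr_const card_ord -(mulr_natl (phi x)) mulrA divfK.
rewrite normrM normfV normr_nat.
have -> : (8 * (4 + pi) / (c%:R * q))%:C = (8 * (4 + pi) / q)%:C / c%:R :> R[i].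
  by rewrite invfM mulrCA mulrC rmorphM /= fmorphV rmorph_nat.
by rewrite ler_wpM2r // invr_ge0 ler0n.
Qed.
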